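(* Let $(G,B,m,w)$ be a connected weighted finite graph with boundary. (1) If $(G|_\Omega,m|_\Omega,w|_\Omega)$ is connected and satisfies the Bakry–Émery curvature-dimension condition $\mathrm{CD}(K,n)$ for some $K>0$ and $n>1$, then $$\lambda_i\ge\frac{nK}{n-1}+\operatorname{Deg}_B^{(i-1)}\quad\text{and}\quad\nu_i\ge\frac{nK}{n-1}+\lambda_{i-1}(\operatorname{Deg}_B\cdot I_\Omega-A_BL_B^{-1}A_\Omega)$$ for $i=2,3,\dots,|\Omega|$. (2) If $G|_\Omega$ is connected and the Ollivier curvature of $(G|_\Omega,m|_\Omega,w|_\Omega)$ has a positive lower bound $\kappa$, then $$\lambda_i\ge\kappa+\operatorname{Deg}_B^{(i-1)}\quad\text{and}\quad\nu_i\ge\kappa+\lambda_{i-1}(\operatorname{Deg}_B\cdot I_\Omega-A_BL_B^{-1}A_\Omega)$$ for $i=2,3,\dots,|\Omega|$.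
   Context: A weighted finite graph $(G,m,w)$ is a finite simple graph $G$ with vertex set $V$ and edge set $E$, a vertex-measure $m:V\to(0,\infty)$ and an edge-weight $w:E\to(0,\infty)$; $w$ is extended to a symmetric function on $V\times V$ by $w_{xy}=0$ when $\{x,y\}\notin E$. A weighted finite graph with boundary $(G,B,m,w)$ is a weighted finite graph with a nonempty subset $B\subset V$ (the boundary); $\Omega=V\setminus B$ is the interior, and $(G|_\Omega,m|_\Omega,w|_\Omega)$ is the induced subgraph on $\Omega$ with inherited weights. $\mathbb{R}^S$ is the space of real functions on $S$, with inner product $\langle u,v\rangle_S=\sum_{x\in S}u(x)v(x)m_x$. For $x\in\Omega$, $\operatorname{Deg}_B(x)=\frac1{m_x}\sum_{y\in B}w_{xy}$; $\operatorname{Deg}_B^{(1)}\le\dots\le\operatorname{Deg}_B^{(|\Omega|)}$ is the nondecreasing rearrangement of these values over $x\in\Omega$; $\operatorname{Deg}_B\cdot I_\Omega$ is multiplication by $\operatorname{Deg}_B$ on $\mathbb{R}^\Omega$. Laplacian: $\Delta u(x)=\frac1{m_x}\sum_{y\in V}(u(x)-u(y))w_{xy}$ for $u\in\mathbb{R}^V$. Dirichlet Laplacian: for $u\in\mathbb{R}^\Omega$ let $E_0(u)\in\mathbb{R}^V$ be its extension by $0$ on $B$, and $\Delta^Du=(\Delta E_0(u))|_\Omega$, a nonnegative self-adjoint operator on $\mathbb{R}^\Omega$ with eigenvalues (Dirichlet eigenvalues), counted with multiplicity, $0\le\lambda_1\le\dots\le\lambda_{|\Omega|}$. Neumann Laplacian: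 for $u\in\mathbb{R}^\Omega$, let $N_0(u)\in\mathbb{R}^V$ be the unique function with $N_0(u)=u$ on $\Omega$ and $\Delta N_0(u)=0$ on $B$. Set $\Delta^N u=(\Delta N_0(u))|_\Omega$, a nonnegative self-adjoint operator on $\mathbb{R}^\Omega$ with eigenvalues (Neumann eigenvalues), counted with multiplicity, $0\le\nu_1\le\dots\le\nu_{|\Omega|}$. Weighted adjacency operators: $A_B:\mathbb{R}^B\to\mathbb{R}^\Omega$, $A_Bu(x)=\frac1{m_x}\sum_{y\in B}u(y)w_{xy}$ for $x\in\Omega$, and $A_\Omega:\mathbb{R}^\Omega\to\mathbb{R}^B$, $A_\Omega u(x)=\frac1{m_x}\sum_{y\in\Omega}u(y)w_{xy}$ for $x\in B$. $L_B:\mathbb{R}^B\to\mathbb{R}^B$ is $L_Bf=(\Delta\tilde f)|_B$, where $\tilde f$ is the extension of $f$ by $0$ on $\Omega$; it is invertible. For a self-adjoint operator $T$, $\lambda_1(T)\le\lambda_2(T)\le\cdots$ are its eigenvalues counted with multiplicity. Curvature conditions, for a connected weighted finite graph $(H,m,w)$ with vertex set $V_H$ and Laplacian $\Delta_H f(x)=\frac1{m_x}\sum_{y\in V_H}(f(x)-f(y))w_{xy}$ (applied here with $H=G|_\Omega$): put $L=-\Delta_H$, $\Gamma(f,g)=\frac12(L(fg)-fLg-gLf)$, $\Gamma_2(f,f)=\frac12L\Gamma(f,f)-\Gamma(f,Lf)$. $\mathrm{CD}(K,n)$ means $\Gamma_2(f,f)(x)\ge\frac1n(Lf(x))^2+K\,\Gamma(f,f)(x)$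 for all $f\in\mathbb{R}^{V_H}$, $x\in V_H$. Ollivier curvature (Münch–Wojciechowski): with $d$ the combinatorial graph distance of $H$, for $x\ne y$, $$\kappa(x,y)=\inf\left\{\frac{\Delta_Hf(y)-\Delta_Hf(x)}{d(x,y)}\ \Big|\ f\in\mathbb{R}^{V_H}\text{ 1-Lipschitz for }d,\ f(y)-f(x)=d(x,y)\right\};$$ it has lower bound $\kappa$ if $\kappa(x,y)\ge\kappa$ for all $x\ne y$. *)

(* Defs.v *)
Set Warnings "-notation-overridden,-ambiguous-paths,-redundant-canonical-projection".
From HB Require Import structures.
From mathcomp Require Import all_boot all_order all_algebra.
From mathcomp Require polyrcf.
From mathcomp Require Import boolp classical_sets reals constructive_ereal ereal.

Set Implicit Arguments.
Unset Strict Implicit.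
Unset Printing Implicit Defensive.
Import Order.TTheory GRing.Theory Num.Theory.
Local Open Scope ring_scope.

Record wgraph (R : realType) := WGraph {
  vertex :> finType;
  adj : rel vertex;
  adj_sym : symmetric adj;
  adj_irr : irreflexive adj;
  mass : vertex -> R;
  mass_gt0 : forall x, 0 < mass x;
  weight : vertex -> vertex -> R;
  weight_sym : forall x y, weight x y = weight y x;
  weight_gt0 : forall x y, adj x y -> 0 < weight x y;
  weight_eq0 : forall x y, ~~ adj x y -> weight x y = 0 }.

(* The space of real functions on a finite type. The regular module R^o makes
   it an R-vector space, so that linear operators on it have type 'End(_). *)
Notation rfun R T := {ffun T%type -> R^o}.

Notation subV S := {x | x \in S}.

Section Graphs.
Variable R : realType.

Definition connected (G : wgraph R) : Prop :=
  forall x y : G, connect (@adj R G) x y.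

Definition induced (G : wgraph R) (S : {set G}) : wgraph R :=
  @WGraph R (subV S)
    (fun x y => adj (val x) (val y))
    (fun x y => adj_sym (val x) (val y))
    (fun x => adj_irr (val x))
    (fun x => mass (val x))
    (fun x => mass_gt0 (val x))
    (fun x y => weight (val x) (val y))
    (fun x y => weight_sym (val x) (val y))
    (fun x y => @weight_gt0 R G (val x) (val y))
    (fun x y => @weight_eq0 R G (val x) (val y)).

Definition laplacian (G : wgraph R) (u : rfun R G) : rfun R G :=
  [ffun x => (mass x)^-1 * \sum_y (u x - u y) * weight x y].

Let lin_sum (T : finType) (a c : R) (f g : T -> R) :
  c * \sum_i (a * f i + g i) = a * (c * \sum_i f i) + c * \sum_i g i.
Proof. by rewrite big_split -mulr_sumr mulrDr mulrCA. Qed.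

Fact laplacian_linear (G : wgraph R) : linear (@laplacian G).
Proof.
move=> a u v; apply/ffunP=> x; rewrite !ffunE /GRing.scale/=.
rewrite -lin_sum; congr (_ * _); apply: eq_bigr => y _.
by rewrite !ffunE /GRing.scale/= mulrA -mulrDl mulrBr opprD addrACA.
Qed.

HB.instance Definition _ (G : wgraph R) :=
  GRing.isLinear.Build R (rfun R G)
  (rfun R G) *:%R (@laplacian G) (@laplacian_linear G).

Section CurvatureDimension.
Variable H : wgraph R.

Definition Lop (f : rfun R H) : rfun R H := - laplacian f.

Definition Gam (f g : rfun R H) : rfun R H :=
  2^-1 *: (Lop (f * g) - f * Lop g - g * Lop f).

Definition Gam2 (f : rfun R H) : rfun R H :=
  2^-1 *: Lop (Gam f f) - Gam f (Lop f).

Definition CD (K n : R) : Prop := forall (f : rfun R H) (x : H),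
  n^-1 * (Lop f x : R) ^+ 2 + K * (Gam f f x : R) <= (Gam2 f x : R).

End CurvatureDimension.

Section Ollivier.
Variable H : wgraph R.

(* Length of a shortest path from x to y; a shortest path has fewer than #|H|
   edges, so the search finds it whenever x and y are connected. *)
Definition gdist (x y : H) : nat :=
  find (fun k => [exists p : k.-tuple H, path (@adj R H) x p && (last x p == y)])
    (iota 0 #|H|).

Definition lipschitz1 (f : rfun R H) : Prop :=
  forall x y : H, `|(f x - f y : R)| <= (gdist x y)%:R.

(* The infimum is taken in the extended reals, where it is always meaningful;
   on a connected graph it is the infimum of a nonempty bounded set of reals. *)
Definition ollivier (x y : H) : \bar R :=
  ereal_inf
    [set ((laplacian f y - laplacian f x : R) / (gdist x y)%:R)%:E
      | f in [set f : rfun R H | lipschitz1 f /\ f y - f x = (gdist x y)%:R]]%classic.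

Definition ollivier_ge (k : R) : Prop :=
  forall x y : H, x != y -> (k%:E <= ollivier x y)%E.

End Ollivier.

Section Boundary.
Variables (G : wgraph R) (B : {set G}).
Local Notation Om := (~: B).

Definition ext0 (S : {set G}) (u : rfun R (subV S)) : rfun R G :=
  [ffun x => oapp u 0 (insub x)].

Definition restr (S : {set G}) (u : rfun R G) : rfun R (subV S) :=
  [ffun x => u (val x)].

Fact ext0_linear (S : {set G}) : linear (@ext0 S).
Proof.
move=> a u v; apply/ffunP=> x; rewrite !ffunE.
by case: insubP => [y _ _|_] /=; rewrite ?ffunE// scaler0 addr0.
Qed.

HB.instance Definition _ (S : {set G}) :=
  GRing.isLinear.Build R (rfun R (subV S))
  (rfun R G) *:%R (@ext0 S) (@ext0_linear S).

Fact restr_linear (S : {set G}) : linear (restr S).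
Proof. by move=> a u v; apply/ffunP=> x; rewrite !ffunE. Qed.

HB.instance Definition _ (S : {set G}) :=
  GRing.isLinear.Build R (rfun R G)
  (rfun R (subV S)) *:%R (restr S) (@restr_linear S).

Definition dirichlet_lap (u : rfun R (subV Om)) : rfun R (subV Om) :=
  restr Om (laplacian (ext0 u)).

(* The function equal to u on the interior and harmonic on B: it exists and is
   unique when G is connected and B is a proper subset (see harm_extP), and is
   then linear in u (see neumann_lap_linear). *)
Definition harm_ext (u : rfun R (subV Om)) : rfun R G :=
  xget 0 [set f | restr Om f = u /\ restr B (laplacian f) = 0]%classic.

Definition neumann_lap (u : rfun R (subV Om)) : rfun R (subV Om) :=
  restr Om (laplacian (harm_ext u)).

(* The weighted adjacency operators: A_B is wadj B Om, A_Omega is wadj Om B. *)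
Definition wadj (S T : {set G}) (u : rfun R (subV S)) : rfun R (subV T) :=
  [ffun x => (mass (val x))^-1 * \sum_(y : subV S) u y * weight (val x) (val y)].

Definition LB (f : rfun R (subV B)) : rfun R (subV B) :=
  restr B (laplacian (ext0 f)).

Definition DegB (x : subV Om) : R :=
  (mass (val x))^-1 * \sum_(y in B) weight (val x) y.

(* i-th value (counting from 1) of Deg_B in nondecreasing order *)
Definition DegB_sorted (i : nat) : R :=
  nth 0 (sort <=%R [seq DegB x | x : subV Om]) i.-1.

Definition mulDegB (u : rfun R (subV Om)) : rfun R (subV Om) :=
  [ffun x => DegB x * u x].

Fact dirichlet_lap_linear : linear dirichlet_lap.
Proof. by move=> a u v; rewrite /dirichlet_lap !linearP. Qed.

HB.instance Definition _ :=
  GRing.isLinear.Build R (rfun R (subV Om))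
  (rfun R (subV Om)) *:%R dirichlet_lap dirichlet_lap_linear.

Fact wadj_linear (S T : {set G}) : linear (@wadj S T).
Proof.
move=> a u v; apply/ffunP=> x; rewrite !ffunE /GRing.scale/=.
rewrite -lin_sum; congr (_ * _); apply: eq_bigr => y _.
by rewrite !ffunE /GRing.scale/= mulrA -mulrDl.
Qed.

HB.instance Definition _ (S T : {set G}) :=
  GRing.isLinear.Build R (rfun R (subV S))
  (rfun R (subV T)) *:%R (@wadj S T) (@wadj_linear S T).

Fact LB_linear : linear LB.
Proof. by move=> a u v; rewrite /LB !linearP. Qed.

HB.instance Definition _ :=
  GRing.isLinear.Build R (rfun R (subV B))
  (rfun R (subV B)) *:%R LB LB_linear.

Fact mulDegB_linear : linear mulDegB.
Proof.
by move=> a u v; apply/ffunP=> x; rewrite !ffunE /GRing.scale/= mulrDr mulrCA.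
Qed.

HB.instance Definition _ :=
  GRing.isLinear.Build R (rfun R (subV Om))
  (rfun R (subV Om)) *:%R mulDegB mulDegB_linear.

Hypotheses (Gconn : connected G) (Bproper : Om != finset.set0).

Let restr_eq0 (S : {set G}) (f : rfun R G) : restr S f = 0 ->
  forall x, x \in S -> f x = 0.
Proof.
move=> /ffunP f0 x xS.
by have := f0 (exist (fun x => x \in S) x xS); rewrite !ffunE.
Qed.

Let laplacian_max (g : rfun R G) (x : G) : (laplacian g x : R) = 0 ->
  (forall y, (g y : R) <= g x) -> forall y, adj x y -> g y = g x.
Proof.
rewrite ffunE => /eqP; rewrite mulf_eq0 invr_eq0 gt_eqF ?mass_gt0//= => lap0 gmax.
have ge0 y : 0 <= ((g x - g y) * weight x y : R).
  have [xy|/weight_eq0->] := boolP (adj x y); last by rewrite mulr0.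
  by rewrite mulr_ge0 ?subr_ge0 ?gmax// ltW ?weight_gt0.
move: lap0; rewrite psumr_eq0// => /allP lap0 y xy.
have /eqP := lap0 y (mem_index_enum y).
move=> /eqP; rewrite mulf_eq0 subr_eq0 => /orP[/eqP->//|].
by rewrite gt_eqF ?weight_gt0.
Qed.

Let laplacian_le0 (g : rfun R G) :
  restr Om g = 0 -> restr B (laplacian g) = 0 -> forall x, (g x : R) <= 0.
Proof.
move=> gOm gB x0.
have [x _ xmax] := @Order.TotalTheory.arg_maxP _ R G x0 xpredT g isT.
have {xmax} gmax y : (g y : R) <= g x by exact: xmax.
rewrite (le_trans (gmax x0))// leNgt; apply/negP => gx.
have same z : connect (@adj R G) x z -> g z = g x.
  case/connectP=> p; elim/last_ind: p z => [z _ ->//|p y IHp z].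
  rewrite rcons_path last_rcons => /andP[xp ey] ->.
  have {}IHp := IHp _ xp erefl.
  rewrite -IHp; apply: (laplacian_max _ _ ey); last by move=> t; rewrite IHp.
  have [lB|lO] := boolP (last x p \in B).
    exact: (restr_eq0 gB lB).
  have lO' : last x p \in Om by rewrite finset.in_setC.
  by move: gx; rewrite -IHp (restr_eq0 gOm lO') ltxx.
have /finset.set0Pn[z zOm] := Bproper.
by move: gx; rewrite -(same z (Gconn x z)) (restr_eq0 gOm zOm) ltxx.
Qed.

Let laplacian_eq0 (g : rfun R G) :
  restr Om g = 0 -> restr B (laplacian g) = 0 -> g = 0.
Proof.
move=> gOm gB; apply/ffunP => x; apply/eqP; rewrite ffunE.
rewrite (_ : (g x == 0) = ((g x : R) == 0))// eq_le laplacian_le0//=.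
rewrite -oppr_le0; have := @laplacian_le0 (- g) _ _ x; rewrite !ffunE; apply.
  by rewrite linearN/= gOm oppr0.
by rewrite !linearN/= gB oppr0.
Qed.

Let ext0_restr (S : {set G}) (u : rfun R (subV S)) : restr S (ext0 u) = u.
Proof. by apply/ffunP => x; rewrite !ffunE valK. Qed.

Let ext0_restrC (S T : {set G}) (u : rfun R (subV S)) :
  [disjoint S & T] -> restr T (ext0 u) = 0.
Proof.
move=> ST; apply/ffunP => -[x xT]; rewrite !ffunE insubN//=.
by apply/negP => xS; have /pred0P/(_ x)/= := ST; rewrite xS xT.
Qed.

Lemma LB_inj : lker (linfun LB) == 0%VS.
Proof.
apply/lker0P => u v; rewrite !lfunE /= => /eqP.
rewrite -subr_eq0 -linearB /= => /eqP LB0; apply/eqP; rewrite -subr_eq0.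
rewrite -[u - v]ext0_restr (@laplacian_eq0 (ext0 (u - v))) ?linear0//.
by apply: ext0_restrC; rewrite finset.disjoints_subset finset.setCK.
Qed.

Lemma harm_extP (u : rfun R (subV Om)) (f : rfun R G) :
  f = harm_ext u <-> restr Om f = u /\ restr B (laplacian f) = 0.
Proof.
have exN : restr Om (harm_ext u) = u /\ restr B (laplacian (harm_ext u)) = 0.
  apply: (@xgetPex _ 0 [set f | restr Om f = u /\ restr B (laplacian f) = 0]%classic).
  exists (ext0 u - ext0 ((linfun LB)^-1%VF (restr B (laplacian (ext0 u))))).
  rewrite /= !linearB/= ext0_restr ext0_restrC ?subr0; last first.
    by rewrite finset.disjoints_subset finset.setCK.
  split=> //; set v := restr B _.
  by have := lker0_lfunVK LB_inj v; rewrite lfunE /= /LB => ->; rewrite subrr.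
split=> [->//|[fOm fB]]; apply/eqP; rewrite -subr_eq0; apply/eqP.
by apply: laplacian_eq0; rewrite !linearB/= (fOm, fB) (exN.1, exN.2) subrr.
Qed.

Lemma neumann_lap_linear : linear neumann_lap.
Proof.
move=> a u v; rewrite /neumann_lap -!linearP; congr (restr _ (laplacian _)).
apply/esym/harm_extP; rewrite !linearP/=.
have [uOm uB] := (harm_extP u (harm_ext u)).1 erefl.
have [vOm vB] := (harm_extP v (harm_ext v)).1 erefl.
by rewrite uOm vOm uB vB scaler0 addr0.
Qed.

End Boundary.

End Graphs.

Section Eigenvalues.
Variables (R : realType) (V : vectType R).

(* The real eigenvalues in nondecreasing order, each repeated as many times as
   the dimension of its eigenspace; see eigenvaluesP. *)
Definition eigenvalues (T : 'End(V)) : seq R :=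
  xget [::] [set s | sorted <=%R s /\
    forall a, count_mem a s = \dim (passmx.leigenspace T a)]%classic.

Lemma eigenvaluesP (T : 'End(V)) : sorted <=%R (eigenvalues T) /\
  forall a, count_mem a (eigenvalues T) = \dim (passmx.leigenspace T a).
Proof.
apply: (@xgetPex _ [::] [set s | sorted <=%R s /\
    forall a, count_mem a s = \dim (passmx.leigenspace T a)]%classic).
pose e := vbasis {:V}; have eB : basis_of {:V} e := vbasisP _.
pose p := char_poly (passmx.mxof e e T).
pose rs := polyrcf.rootsR p.
pose d a := \dim (passmx.leigenspace T a).
pose t := flatten [seq nseq (d a) a | a <- rs].
exists (sort <=%R t); split => [|a]; first exact: (sort_sorted le_total).
rewrite (permP (permEl (perm_sort _ _))) count_flatten -map_comp.
rewrite sumnE big_map (eq_bigr (fun b => (b == a) * d b)%N); last first.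
  by move=> b _; rewrite /= count_nseq.
have rootsE : root p a = (a \in rs).
  by have /(_ a) := polyrcf.roots_on_rootsR (monic_neq0 (char_poly_monic (passmx.mxof e e T))).
have [ars|] := boolP (a \in rs).
  rewrite (bigD1_seq a)//= ?polyrcf.uniq_roots// eqxx mul1n big1 ?addn0// => b /negPf->.
  by rewrite mul0n.
rewrite -rootsE -eigenvalue_root_char negbK => eig0.
rewrite (passmx.leigenspaceE eB) (eqP eig0) (passmx.vsof0 eB) dimv0.
rewrite big_seq big1// => b brs; case: eqVneq => // ba.
by move: eig0; rewrite -[_ == 0]negbK -/(eigenvalue _ _) eigenvalue_root_char rootsE -ba brs.
Qed.

(* i-th eigenvalue, counting from 1 *)
Definition eigval (T : 'End(V)) (i : nat) : R := nth 0 (eigenvalues T) i.-1.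

End Eigenvalues.

(* linfun f is the endomorphism with underlying function f whenever f is linear. *)
Section Operators.
Variables (R : realType) (G : wgraph R) (B : {set G}).

Definition dirichlet_op : 'End(rfun R (subV (~: B))) := linfun (@dirichlet_lap R G B).

Definition neumann_op : 'End(rfun R (subV (~: B))) := linfun (@neumann_lap R G B).

(* Deg_B I_Omega - A_B L_B^-1 A_Omega; _^-1%VF is the two-sided
   inverse because LB is injective (LB_inj). *)
Definition schur_op : 'End(rfun R (subV (~: B))) :=
  (linfun (@mulDegB R G B)
   - (linfun (@wadj R G B (~: B)) \o (linfun (@LB R G B))^-1
        \o linfun (@wadj R G (~: B) B)))%VF.

End Operators.

(* Main.v *)
(** Let D be the Laplacian of the induced graph on the interior. The Dirichlet
    Laplacian is D + Deg_B and the Neumann Laplacian is D + (Deg_B - A_B L_B^-1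
    A_Omega), so Weyl's inequality lambda_i(D + T) >= lambda_2(D) +
    lambda_(i-1)(T) reduces both claims to a lower bound on lambda_2(D), that is,
    on the nonzero eigenvalues of D. For CD(K, n) the bound is Lichnerowicz's:
    integrate the curvature inequality over an eigenfunction. For Ollivier
    curvature, an eigenfunction f divided by its largest Lipschitz quotient,
    attained at x and y, is admissible in the infimum defining the curvature of
    x and y, where it yields exactly the eigenvalue. *)
From HB Require Import structures.
From mathcomp Require Import boolp classical_sets constructive_ereal ereal.
From mathcomp Require Import spectral complex zify ring.
Require Import Defs.
From mathcomp Require Import all_boot all_order all_algebra.
From mathcomp Require Import reals.
Import Order.TTheory GRing.Theory Num.Theory passmx.
Set Implicit Arguments.
Unset Strict Implicit.
Unset Printing Implicit Defensive.
Local Open Scope ring_scope.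

(** * Spectral theorem and Weyl's inequality *)

Section Preliminaries.
Variable R : realType.

(** The complexification of [A] is hermitian, hence diagonalizable with real spectrum, and real
    matrices similar over the complex numbers are similar over [R]. The rows of [P] are
    eigenvectors. *)
Lemma symmetric_diagonalization n (A : 'M[R]_n) : A^T = A ->
  exists2 P : 'M[R]_n, P \in unitmx &
    exists d : 'rV[R]_n, P *m A = diag_mx d *m P.
Proof.
move=> AT; pose c := @real_complex R.
pose Ac : 'M[complex R]_n := map_mx c A.
have rE (p q : nat) (M : 'M[R]_(p, q)) : map_mx c M \is a mxOver Num.real.
  by apply/mxOverP => i j; rewrite mxE; apply/complex_realP; eexists.
have pull (p q : nat) (M : 'M[complex R]_(p, q)) :
    M \is a mxOver Num.real -> exists N, M = map_mx c N.
  move=> /mxOverP Mr; exists (map_mx (@complex.Re R) M); apply/matrixP => i j.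
  by rewrite !mxE; apply/esym/RRe_real/Mr.
have Ah : Ac \is hermitianmx _ false Num.conj.
  apply: realsym_hermsym (rE _ _ _); apply/is_hermitianmxP.
  by rewrite expr0 scale1r map_mx_id// /Ac map_trmx AT.
have [d dE] := pull _ _ _ (hermitian_spectral_diag_real Ah).
have /orthomx_spectralP := hermitian_normalmx Ah.
rewrite dE -map_diag_mx => AE.
have sim : similar_in unitmx Ac (map_mx c (diag_mx d)).
  exists (spectralmx Ac); first exact: spectral_unit.
  apply/similarP; first exact: spectral_unit.
  by rewrite {2}AE !mulmxA mulmxV ?mul1mx ?spectral_unit.
have [P /andP[/pull[Q ->] Qu] /(similarP Qu) PE] :=
  real_similar sim (rE _ _ _) (rE _ _ _).
exists Q; first by rewrite -(map_unitmx c).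
by exists d; apply: (map_mx_inj (f := c)); rewrite !map_mxM.
Qed.

Lemma sum_count_mem (r s : seq R) : uniq r ->
  (\sum_(a <- r) count_mem a s = count (mem r) s)%N.
Proof.
move=> ur; under eq_bigr do rewrite -sum1_count big_mkcond.
rewrite exchange_big/= -sum1_count [RHS]big_mkcond; apply: eq_bigr => b _.
rewrite -big_mkcond/= sum1_count (eq_count (a2 := pred1 b)); last first.
  by move=> a; rewrite /= eq_sym.
by rewrite count_uniq_mem// -[mem r b]/(b \in r); case: (b \in r).
Qed.

Lemma count_le_nth (s : seq R) i : sorted <=%R s -> (i < size s)%N ->
  (i < count (fun a => a <= nth 0 s i)%R s)%N.
Proof.
move=> ss si; rewrite -{2}(cat_take_drop i.+1 s) count_cat.
apply: leq_trans (leq_addr _ _); suff /eqP -> : count (fun a => a <= nth 0 s i)%R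
  (take i.+1 s) == size (take i.+1 s) by rewrite size_takel.
rewrite -all_count; apply/(all_nthP 0) => j; rewrite size_takel// => ji.
rewrite nth_take//; apply: (sorted_leq_nth le_trans lexx 0 ss) => //.
by rewrite inE (leq_trans ji).
Qed.

Lemma count_ge_nth (s : seq R) i : sorted <=%R s ->
  (size s - i <= count (fun a => nth 0 s i <= a)%R s)%N.
Proof.
move=> ss; rewrite -{3}(cat_take_drop i s) count_cat.
apply: leq_trans (leq_addl _ _); suff /eqP -> : count (fun a => nth 0 s i <= a)
  (drop i s) == size (drop i s) by rewrite size_drop.
rewrite -all_count; apply/(all_nthP 0) => j; rewrite size_drop => ji.
rewrite nth_drop; have si : (i + j < size s)%N by rewrite -ltn_subRL.
apply: (sorted_leq_nth le_trans lexx 0 ss); rewrite ?inE ?leq_addr//.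
exact: leq_ltn_trans (leq_addr _ _) si.
Qed.

End Preliminaries.

(** * Self-adjoint operators for a weighted inner product *)

Section WeightedInnerProduct.
Variables (R : realType) (X : finType) (m : X -> R).
Hypothesis m_gt0 : forall x, 0 < m x.
Local Notation V := (rfun R X).
Implicit Types (u v w : V) (T : 'End(V)).

Definition ip u v : R := \sum_x m x * ((u x : R) * v x).

Lemma ipC u v : ip u v = ip v u.
Proof. by apply: eq_bigr => x _; congr (_ * _); rewrite mulrC. Qed.

Lemma ipDl u v w : ip (u + v) w = ip u w + ip v w.
Proof.
by rewrite /ip -big_split; apply: eq_bigr => x _; rewrite /= ffunE mulrDl mulrDr.
Qed.

Lemma ipZl a u v : ip (a *: u) v = a * ip u v.
Proof.
by rewrite /ip mulr_sumr; apply: eq_bigr => x _;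
  rewrite ffunE /GRing.scale/= -mulrA mulrCA.
Qed.

Lemma ipDr u v w : ip u (v + w) = ip u v + ip u w.
Proof. by rewrite ipC ipDl 2!(ipC u). Qed.

Lemma ipZr a u v : ip u (a *: v) = a * ip u v.
Proof. by rewrite ipC ipZl (ipC u). Qed.

Lemma ip0l u : ip 0 u = 0.
Proof. by rewrite -(scale0r 0) ipZl mul0r. Qed.

Lemma ip_suml (I : finType) (f : I -> V) u :
  ip (\sum_i f i) u = \sum_i ip (f i) u.
Proof. by apply: (big_morph (ip^~ u)) => [v w|]; rewrite ?ipDl ?ip0l. Qed.

Lemma ip_term_ge0 u x : 0 <= m x * ((u x : R) * u x).
Proof. exact: mulr_ge0 (ltW (m_gt0 x)) (sqr_ge0 (u x : R)). Qed.

Lemma ip_ge0 u : 0 <= ip u u.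
Proof. by apply: sumr_ge0 => x _; apply: ip_term_ge0. Qed.

Lemma ip_eq0 u : (ip u u == 0) = (u == 0).
Proof.
apply/idP/eqP => [|->]; last by rewrite ip0l.
rewrite psumr_eq0 => [/allP u0|x _]; last exact: ip_term_ge0.
apply/ffunP => x; have /eqP := u0 x (mem_index_enum x).
rewrite ffunE => /eqP; rewrite mulf_eq0 gt_eqF//= => ux0.
by apply/eqP; rewrite -[_ == _](orbb (u x == 0)) -mulf_eq0.
Qed.

Definition selfadj T := forall u v, ip (T u) v = ip u (T v).

Lemma dim_rfun : \dim {: V} = #|X|.
Proof. by rewrite dimvf /dim/= muln1. Qed.

(** Point indicators divided by the square root of the mass work. In such a basis self-adjoint
    operators have symmetric matrices. *)
Lemma orthonormal_basis : exists2 e : (\dim {: V}).-tuple V,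
  basis_of {: V} e & forall i j : 'I_(\dim {: V}), ip e`_i e`_j = (i == j)%:R.
Proof.
pose x_ (i : 'I_(\dim {: V})) : X := enum_val (cast_ord dim_rfun i).
pose d i : V := [ffun x => (x == x_ i)%:R / Num.sqrt (m x)].
pose e := [tuple d i | i < \dim {: V}].
have eE (i : 'I_(\dim {: V})) : e`_i = d i by rewrite -tnth_nth tnth_mktuple.
have x_inj : injective x_ by move=> i j /enum_val_inj/cast_ord_inj.
have orth (i j : 'I_(\dim {: V})) : ip e`_i e`_j = (i == j)%:R.
  rewrite !eE /ip (bigD1 (x_ i))//= big1 ?addr0 => [|x /negPf xi].
    rewrite !ffunE eqxx (inj_eq x_inj);
      case: eqP => _; last by rewrite !(mul0r, mulr0).
    by rewrite !mul1r -invfM -expr2 sqr_sqrtr ?ltW// divff ?gt_eqF.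
  by rewrite !ffunE xi !(mul0r, mulr0).
exists e => //; rewrite basisEfree subvf size_tuple leqnn !andbT.
apply/freeP => k k0 i.
have := congr1 (ip^~ e`_i) k0; rewrite /= ip0l ip_suml (bigD1 i)//= big1.
  by rewrite ipZl orth eqxx mulr1 addr0.
by move=> j /negPf ji; rewrite ipZl orth ji mulr0.
Qed.

Lemma memv_leigenspace T a v : (v \in leigenspace T a) = (T v == a *: v).
Proof. by rewrite memv_ker !lfun_simp subr_eq0. Qed.

Definition eigsum T (r : seq R) : {vspace V} :=
  (\sum_(a <- r) leigenspace T a)%VS.

(** The rows of the matrix diagonalizing [T] in an orthonormal basis are coordinates of
    eigenvectors, and they span because that matrix is invertible. *)
Lemma eigsum_full T : selfadj T -> exists r, eigsum T r = fullv.
Proof.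
move=> Tsym; have [e eB eorth] := orthonormal_basis.
have coordE v i : coord e i v = ip v e`_i.
  rewrite {2}(coord_basis eB (memvf v)) ip_suml (bigD1 i)//= big1.
    by rewrite ipZl eorth eqxx mulr1 addr0.
  by move=> j /negPf ji; rewrite ipZl eorth ji mulr0.
pose A := mxof e e T.
have AT : A^T = A.
  apply/matrixP => i j; rewrite !mxE /= !vecof_delta !coordE.
  by rewrite Tsym ipC.
have [P Pu [d dE]] := symmetric_diagonalization AT.
exists [seq d 0 i | i : 'I_(\dim {: V})].
apply/eqP; rewrite eqEsubv subvf; apply/subvP => v _.
rewrite -[v](rVofK eB) -[rVof e v](mulmxKV Pu).
rewrite mulmx_sum_row linear_sum /=; apply: memv_suml => i _.
rewrite linearZ /=; apply: memvZ.
have iin : d 0 i \in [seq d 0 i | i : 'I_(\dim {: V})] by apply: image_f.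
rewrite /eigsum (big_rem _ iin)/=; apply: (subvP (addvSl _ _)).
rewrite memv_leigenspace -[T _](rVofK eB) (rVof_app e eB).
rewrite vecofK// -/A -row_mul dE row_mul row_diag_mx -scalemxAl -rowE.
by rewrite linearZ.
Qed.

Lemma eigsum_orth T r a u v : selfadj T -> a \notin r ->
  u \in leigenspace T a -> v \in eigsum T r -> ip u v = 0.
Proof.
move=> Tsym; rewrite memv_leigenspace => + /eqP Tu.
elim: r v => [|b r IHr] v; rewrite /eigsum (big_nil, big_cons).
  by move=> _; rewrite memv0 => /eqP->; rewrite ipC ip0l.
rewrite inE negb_or => /andP[ab ar] /memv_addP[w + [z zr ->]].
rewrite memv_leigenspace => /eqP Tw; rewrite ipDr (IHr z)// addr0.
have := Tsym u w; rewrite Tu Tw ipZl ipZr => /eqP.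
by rewrite -subr_eq0 -mulrBl mulf_eq0 subr_eq0 (negPf ab) => /eqP.
Qed.

(** Orthogonality makes the sum of eigenspaces direct, and each dimension is a multiplicity in
    [eigenvalues T]. *)
Lemma dim_eigsum T r : selfadj T -> uniq r ->
  \dim (eigsum T r) = (\sum_(a <- r) count_mem a (eigenvalues T))%N.
Proof.
move=> Tsym; elim: r => [|a r IHr]; rewrite /eigsum !(big_nil, big_cons).
  by rewrite dimv0.
move=> /andP[ar ur]; rewrite dimv_disjoint_sum ?IHr// ?(eigenvaluesP T).2//.
apply/eqP; rewrite -subv0; apply/subvP => u /memv_capP[ua ur'].
by rewrite memv0 -ip_eq0 (eigsum_orth Tsym ar ua ur').
Qed.

Lemma size_eigenvalues T : selfadj T -> size (eigenvalues T) = #|X|.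
Proof.
move=> Tsym; have [r rE] := eigsum_full Tsym.
apply/eqP; rewrite eqn_leq -dim_rfun; apply/andP; split.
  have := dim_eigsum Tsym (undup_uniq (eigenvalues T)).
  rewrite sum_count_mem ?undup_uniq// (eq_in_count (a2 := xpredT)) ?count_predT.
    by move=> <-; rewrite dimvS ?subvf.
  by move=> a ain; rewrite [LHS](mem_undup _ a) ain.
(* The spanning list [r] may repeat values; dimensions add up only once the repetitions are
   removed. *)
have sub : (eigsum T r <= eigsum T (undup r))%VS.
  elim: r {rE} => [|a r IHr] /=; first by rewrite /eigsum big_nil sub0v.
  rewrite /eigsum big_cons; rewrite subv_add; apply/andP; split; last first.
    by apply: subv_trans IHr _; case: ifP => // _; rewrite big_cons addvSr.
  have : a \in undup (a :: r) by rewrite mem_undup mem_head.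
  by move=> /= ain; rewrite (big_rem a)// addvSl.
rewrite -rE (leq_trans (dimvS sub))// dim_eigsum ?undup_uniq//.
by rewrite sum_count_mem ?undup_uniq// count_size.
Qed.

(* The sign sigma lets one induction give both the upper and the lower bound. *)
Lemma eigsum_bound T r sigma t u : selfadj T -> uniq r ->
  (forall a, a \in r -> 0 <= sigma * (a - t)) ->
  u \in eigsum T r -> 0 <= sigma * (ip (T u) u - t * ip u u).
Proof.
move=> Tsym; elim: r u => [|a r IHr] u; rewrite /eigsum (big_nil, big_cons).
  by move=> _ _; rewrite memv0 => /eqP->; rewrite linear0 !ip0l mulr0 subr0 mulr0.
move=> /andP[ar ur] rt /memv_addP[v va [w wr ->]].
have vw := eigsum_orth Tsym ar va wr.
have wv : ip w v = 0 by rewrite ipC.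
have /eqP Tv : T v == a *: v by rewrite -memv_leigenspace.
have Twv : ip (T w) v = 0 by rewrite Tsym Tv ipZr wv mulr0.
rewrite linearD/= !(ipDl, ipDr) Tv !ipZl vw wv Twv.
have -> : sigma * (a * ip v v + a * 0 + (0 + ip (T w) w)
    - t * (ip v v + 0 + (0 + ip w w)))
  = sigma * (a - t) * ip v v + sigma * (ip (T w) w - t * ip w w) by ring.
apply: addr_ge0; first by rewrite mulr_ge0 ?ip_ge0 ?rt ?mem_head.
by apply: IHr => // b br; rewrite rt// inE br orbT.
Qed.

(** The max-min (Courant-Fischer) form of the assertion that the eigenvalue of index k + 1 is at
    least t: [U] has codimension at most k. *)
Definition form_ge T t k := exists U : {vspace V},
  (#|X| <= \dim U + k)%N /\ forall u, u \in U -> t * ip u u <= ip (T u) u.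

Lemma dim_eigsum_count T (p : pred R) : selfadj T ->
  \dim (eigsum T (undup (filter p (eigenvalues T)))) = count p (eigenvalues T).
Proof.
move=> Tsym; rewrite dim_eigsum ?undup_uniq// sum_count_mem ?undup_uniq//.
apply: eq_in_count => a ain; rewrite [LHS](mem_undup _ a) mem_filter ain.
by rewrite andbT.
Qed.

(** The eigenspaces for eigenvalues at least [eigval T i] span a suitable subspace: at most [i.-1]
    eigenvalues lie strictly below. *)
Lemma form_ge_eigval T i : selfadj T -> form_ge T (eigval T i) i.-1.
Proof.
move=> Tsym; set t := eigval T i; set s := eigenvalues T.
have [ss _] := eigenvaluesP T.
exists (eigsum T (undup [seq a <- s | t <= a])); split.
  rewrite dim_eigsum_count// addnC -leq_subLR -(size_eigenvalues Tsym).
  exact: count_ge_nth.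
move=> u /(eigsum_bound (sigma := 1) (t := t) Tsym (undup_uniq _)).
rewrite !mul1r subr_ge0; apply=> a; rewrite mem_undup mem_filter => /andP[ta _].
by rewrite mul1r subr_ge0.
Qed.

(** The subspaces [U] and [W] have codimension at most j and k, and the eigenspaces of [S] up to
    [eigval S i] span a [Z] of dimension at least i > j + k. So the three share a nonzero vector, on
    which the form of [S] is bounded from both sides. *)
Lemma weyl (D T S : 'End(V)) c t j k i :
  selfadj S -> (forall u, S u = D u + T u) -> form_ge D c j -> form_ge T t k ->
  (j + k < i <= #|X|)%N -> c + t <= eigval S i.
Proof.
move=> Ssym SE [U [dimU Uc]] [W [dimW Wt]] /andP[jki iN].
set e := eigenvalues S; have [ss _] := eigenvaluesP S.
have i_gt0 : (0 < i)%N by apply: leq_ltn_trans jki.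
pose Z := eigsum S (undup [seq a <- e | a <= eigval S i]).
have dimZ : (i <= \dim Z)%N.
  rewrite dim_eigsum_count// -[leqLHS](prednK i_gt0).
  by apply: count_le_nth => //; rewrite (size_eigenvalues Ssym) prednK.
have [u uUWZ u0] : exists2 u, u \in (U :&: W :&: Z)%VS & u != 0.
  exists (vpick (U :&: W :&: Z)%VS); first exact: memv_pick.
  rewrite vpick0 -dimv_eq0 -lt0n.
  have := dimv_sum_cap (U :&: W)%VS Z; have := dimv_sum_cap U W.
  have : (\dim (U + W) <= #|X|)%N by rewrite -dim_rfun dimvS ?subvf.
  have : (\dim (U :&: W + Z) <= #|X|)%N by rewrite -dim_rfun dimvS ?subvf.
  lia.
move: uUWZ; rewrite !memv_cap => /andP[/andP[uU uW] uZ].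
have uu : 0 < ip u u by rewrite lt_def ip_ge0 ip_eq0 u0.
have Zle a : a \in undup [seq a <- e | a <= eigval S i] ->
    0 <= -1 * (a - eigval S i).
  by rewrite mem_undup mem_filter mulN1r oppr_ge0 subr_le0 => /andP[].
have := eigsum_bound Ssym (undup_uniq _) Zle uZ.
rewrite mulN1r oppr_ge0 subr_le0 => Sle.
rewrite -(ler_pM2r uu); apply: le_trans Sle.
by rewrite SE ipDl mulrDl lerD ?Uc ?Wt.
Qed.

(* U consists of the functions vanishing wherever d < t. *)
Lemma form_ge_mul T (d : X -> R) k :
  (forall u x, T u x = d x * u x) ->
  form_ge T (nth 0 (sort <=%R [seq d x | x : X]) k) k.
Proof.
move=> TE; set s := sort _ _; set t := nth 0 s k.
pose Y := {x : X | ~~ (t <= d x)}.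
pose f (u : V) : rfun R Y := [ffun x => u (val x)].
have f_lin : linear f by move=> a u v; apply/ffunP => x; rewrite !ffunE.
pose fL : {linear V -> rfun R Y} :=
  HB.pack f (GRing.isLinear.Build R _ _ _ f f_lin).
pose F := linfun fL.
have FE u : F u = f u by rewrite lfunE.
exists (lker F); split.
  (* By rank-nullity the kernel has codimension at most the size of [Y]. From index k on, the sorted
     values are at least t, so [Y] has at most k points. *)
  have := limg_ker_dim F fullv; rewrite capfv dim_rfun => <-.
  rewrite leq_add2l (leq_trans (dimvS (subvf _)))// dimvf /dim/= muln1 card_sig.
  have ss : sorted <=%R s := sort_sorted le_total _.
  have := count_ge_nth k ss; rewrite -/t size_sort size_map -cardE.
  rewrite (permP (permEl (perm_sort _ _))) count_map.
  have -> : count (preim d (fun a => t <= a)) (enum X) = #|[pred x | t <= d x]|.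
    by rewrite cardE size_filter enumT.
  have XE : #|X| = (#|[pred x | (t <= d x)%R]| + #|[pred x | ~~ (t <= d x)%R]|)%N.
    by rewrite -(cardC [pred x | t <= d x]).
  by rewrite [in X in X -> _]XE leq_subLR addnC leq_add2r.
move=> u; rewrite memv_ker FE => /eqP/ffunP fu.
rewrite /ip mulr_sumr; apply: ler_sum => x _; rewrite TE.
have [tx|tx] := boolP (t <= d x).
  rewrite -(mulrA (d x)) [leRHS]mulrCA.
  have H := ler_wpM2r (ip_term_ge0 u x) tx.
  exact: H.
have := fu (exist _ x tx); rewrite !ffunE/= => ->.
by rewrite !(mulr0,mul0r).
Qed.

End WeightedInnerProduct.

(** * Spectral gap of the Laplacian under curvature bounds *)

Section Laplacian.
Variables (R : realType) (H : wgraph R).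
Local Notation V := (rfun R H).
Local Notation mip := (ip (@mass R H)).
Implicit Types u v f g : V.

(** Exchanging x and y in the double sum replaces [v x] by [- v y]; averaging both expressions gives
    the factor one half. *)
Lemma laplacian_green u v :
  mip (laplacian u) v
  = 2^-1 * \sum_x \sum_y ((u x : R) - u y) * ((v x : R) - v y) * weight x y.
Proof.
pose S := \sum_x \sum_y ((u x : R) - u y) * weight x y * (v x : R).
have -> : mip (laplacian u) v = S.
  apply: eq_bigr => x _; rewrite ffunE mulrA mulrA.
  rewrite divff ?gt_eqF ?mass_gt0// mul1r.
  by rewrite mulr_suml.
have SE : S = \sum_x \sum_y ((u x : R) - u y) * weight x y * - (v y : R).
  rewrite /S exchange_big; apply: eq_bigr => x _; apply: eq_bigr => y _.
  by rewrite weight_sym; ring.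
have -> : \sum_x \sum_y ((u x : R) - u y) * ((v x : R) - v y) * weight x y
    = S + S.
  rewrite {2}SE -big_split; apply: eq_bigr => x _; rewrite -big_split.
  by apply: eq_bigr => y _ /=; ring.
by field.
Qed.

Lemma laplacian_sym u v : mip (laplacian u) v = mip u (laplacian v).
Proof.
rewrite ipC [in RHS]ipC ipC !laplacian_green; congr (_ * _).
by apply: eq_bigr => x _; apply: eq_bigr => y _; ring.
Qed.

Lemma laplacian_form_ge0 u : 0 <= mip (laplacian u) u.
Proof.
rewrite laplacian_green mulr_ge0 ?invr_ge0// sumr_ge0// => x _.
rewrite sumr_ge0// => y _; rewrite -expr2 mulr_ge0 ?sqr_ge0//.
by have [/weight_gt0/ltW//|/weight_eq0->] := boolP (adj x y).
Qed.

Lemma laplacian_const (c : R) : laplacian ([ffun=> c] : V) = 0.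
Proof.
apply/ffunP => x; rewrite !ffunE big1 ?mulr0// => y _.
by rewrite !ffunE subrr mul0r.
Qed.

(** The energy of [u] vanishes, hence so does each difference along an edge; equality then spreads
    along paths. *)
Lemma laplacian_ker_const u : connected H -> laplacian u = 0 ->
  forall x y, u x = u y.
Proof.
move=> Hc u0; have /eqP := laplacian_green u u.
have ge0 x y : 0 <= ((u x : R) - u y) * ((u x : R) - u y) * weight x y.
  rewrite -expr2 mulr_ge0 ?sqr_ge0//.
  by have [/weight_gt0/ltW//|/weight_eq0->] := boolP (adj x y).
rewrite u0 ip0l eq_sym mulf_eq0 invr_eq0 pnatr_eq0/= psumr_eq0; last first.
  by move=> x _; rewrite sumr_ge0.
move=> /allP all0 x y.
have edge a b : adj a b -> u a = u b.
  move=> ab; have := all0 a (mem_index_enum a); rewrite psumr_eq0// => /allP.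
  move=> /(_ b (mem_index_enum b)); rewrite /= mulf_eq0.
  by rewrite (gt_eqF (weight_gt0 ab)) orbF -expr2 sqrf_eq0 subr_eq0 => /eqP.
have /connectP[p + ->] := Hc x y.
by elim: p x => //= z p IHp x /andP[/edge -> /IHp].
Qed.

Definition lap_op : 'End(V) := linfun (@laplacian R H).

Lemma lap_opE u : lap_op u = laplacian u.
Proof. by rewrite lfunE. Qed.

Lemma lap_op_selfadj : selfadj (@mass R H) lap_op.
Proof. by move=> u v; rewrite !lap_opE laplacian_sym. Qed.

(** By connectedness the kernel contains only constants, so 0 has multiplicity at most one and the
    second eigenvalue is subject to the gap hypothesis. *)
Lemma spectral_gap (c : R) : connected H -> (1 < #|H|)%N -> 0 < c ->
  (forall a f, f != 0 -> laplacian f = a *: f -> a != 0 -> c <= a) ->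
  c <= eigval lap_op 2.
Proof.
move=> Hc H1 c0 gap; set s := eigenvalues lap_op.
have [ss scount] := eigenvaluesP lap_op; rewrite -/s in ss scount.
have ssize : size s = #|H| := size_eigenvalues (@mass_gt0 R H) lap_op_selfadj.
have eig a : a \in s -> a != 0 -> c <= a.
  move=> sa; apply: (gap a (vpick (leigenspace lap_op a))).
    rewrite vpick0 -dimv_eq0 -scount -lt0n -has_count has_pred1 //.
  apply/eqP; have := memv_pick (leigenspace lap_op a).
  by rewrite memv_leigenspace lap_opE.
have sin i : (i < 2)%N -> nth 0 s i \in s.
  by move=> i2; rewrite mem_nth// ssize (leq_trans i2).
rewrite /eigval -/s /=.
(* If the second eigenvalue were 0, the first would be too, as otherwise it would be at least c > 0;
   then 0 would have multiplicity at least two. *)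
have [s1|] := eqVneq (nth 0 s 1) 0; last exact/eig/sin.
have s01 : nth 0 s 0 <= nth 0 s 1.
  by apply: (sorted_leq_nth le_trans lexx 0 ss) => //; rewrite inE ssize// ltnW.
have s0 : nth 0 s 0 = 0.
  apply/eqP; apply: contraT => /(eig _ (sin 0%N isT)) cs.
  by move: s01; rewrite s1 leNgt (lt_le_trans c0 cs).
have : (count_mem 0%R s <= 1)%N.
  rewrite scount.
  apply: (@leq_trans (\dim <[ [ffun=> 1] : V ]>%VS)); last first.
    by rewrite dim_vline; case: eqP.
  apply: dimvS; apply/subvP => u.
  rewrite memv_leigenspace scale0r lap_opE => /eqP.
  move=> /(laplacian_ker_const Hc) uc.
  have [x _] : exists x : H, x \in H by apply/card_gt0P; apply: ltnW.
  apply/vlineP; exists (u x); apply/ffunP => y.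
  by rewrite !ffunE /GRing.scale/= mulr1.
case: (s) ssize s0 s1 => [|a [|b s']] /=; [by move=> h; rewrite -h in H1..|].
by move=> _ -> ->; rewrite eqxx.
Qed.

(** * Integration against the mass and the Lichnerowicz bound *)

Definition integral u : R := \sum_x mass x * (u x : R).

Lemma integralE u : integral u = mip u 1.
Proof. by apply: eq_bigr => x _; rewrite ffunE mulr1. Qed.

Lemma integral_mul u v : integral (u * v) = mip u v.
Proof. by apply: eq_bigr => x _; rewrite ffunE. Qed.

Lemma integral_laplacian u : integral (laplacian u) = 0.
Proof.
rewrite integralE laplacian_sym (_ : laplacian 1 = 0); first by rewrite ipC ip0l.
by rewrite -[RHS](laplacian_const 1).
Qed.

Lemma integralD u v : integral (u + v) = integral u + integral v.
Proof. by rewrite !integralE ipDl. Qed.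

Lemma integralZ (a : R) u : integral (a *: u) = a * integral u.
Proof. by rewrite !integralE ipZl. Qed.

Lemma integralN u : integral (- u) = - integral u.
Proof. by rewrite -scaleN1r integralZ mulN1r. Qed.

Lemma integral_Gam f g : integral (Gam f g) = mip f (laplacian g).
Proof.
rewrite /Gam /Lop !mulrN !opprK integralZ !integralD integralN integral_laplacian.
rewrite !integral_mul oppr0 add0r [mip g _]ipC laplacian_sym.
by field.
Qed.

(** This is the integrated Bochner formula: the Laplacian of [Gam f f] integrates to zero, and
    symmetry moves one Laplacian in the remaining term. *)
Lemma integral_Gam2 f :
  integral (Gam2 f) = mip (laplacian f) (laplacian f).
Proof.
rewrite /Gam2 {1}/Lop integralD integralZ !integralN integral_laplacian.
rewrite integral_Gam -laplacian_sym /Lop -scaleN1r ipZr; ring.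
Qed.

(** Integrated, the curvature condition reads (a^2 / n + K a) |f|^2 <= a^2 |f|^2. Nonnegativity of
    the Laplacian gives a > 0, so a |f|^2 cancels. *)
Lemma CD_eigenvalue_ge (K n a : R) f : CD H K n -> 0 < K -> 1 < n ->
  f != 0 -> laplacian f = a *: f -> a != 0 -> n * K / (n - 1) <= a.
Proof.
move=> HCD K0 n1 f0 fa a0.
have n0 : 0 < n := lt_trans ltr01 n1.
have q0 : 0 < mip f f by rewrite lt_def ip_ge0 ?ip_eq0 ?f0//; apply: mass_gt0.
have : integral (n^-1 *: (Lop f * Lop f) + K *: Gam f f) <= integral (Gam2 f).
  apply: ler_sum => x _; apply: ler_wpM2l; first exact/ltW/mass_gt0.
  by have := HCD f x; rewrite expr2 !ffunE.
rewrite integral_Gam2 integralD (integralZ n^-1) (integralZ K) integral_Gam.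
rewrite integral_mul /Lop fa.
rewrite -scaleN1r !(ipZl, ipZr) => ineq.
have {}a0 : 0 < a.
  rewrite lt_def a0 /=; have := laplacian_form_ge0 f.
  by rewrite fa ipZl pmulr_lge0.
rewrite ler_pdivrMr ?subr_gt0//.
have : n^-1 * (a * a) + K * a <= a * a.
  rewrite -(ler_pM2r q0) mulrDl -!mulrA.
  by rewrite !mulN1r !mulrN opprK in ineq.
have -> : n^-1 * (a * a) + K * a = (n^-1 * a + K) * a by ring.
rewrite ler_pM2r// -(ler_pM2l n0) mulrDr mulrA divff ?gt_eqF// mul1r => ineq'.
by rewrite mulrBr mulr1 lerBrDl (mulrC a).
Qed.

(** The search returns 0 only if the empty walk joins x to y; a failed search returns the length
    [#|H|] of its list, which is positive. *)
Lemma gdist_gt0 (x y : H) : x != y -> (0 < gdist x y)%N.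
Proof.
move=> xy; rewrite /gdist.
have : (0 < #|H|)%N by apply/card_gt0P; exists x.
case: #|H| => // N _ /=; case: existsP => // -[p /andP[_]].
by rewrite (tuple0 p) /= (negPf xy).
Qed.

(* The Lipschitz quotient of the eigenfunction is attained at some pair x, y;
   the rescaled eigenfunction is then admissible in the infimum for x, y. *)
Lemma ollivier_eigenvalue_ge (k a : R) f : ollivier_ge H k ->
  laplacian f = a *: f -> a != 0 -> f != 0 -> k <= a.
Proof.
move=> Hk fa a0 f0.
(* Constants are harmonic, so an eigenfunction with a != 0 takes two distinct values. *)
have [x0 [y0 fxy]] : exists x0 y0, (f x0 : R) != f y0.
  apply: contrapT => noxy; move/negP: f0; apply.
  have fc x y : f x = f y.
    by apply/eqP; apply: contraT => xy; case: noxy; exists x, y.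
  have /eqP := fa; rewrite (_ : laplacian f = 0).
    by rewrite eq_sym scaler_eq0 (negPf a0).
  apply/ffunP => x; rewrite !ffunE big1 ?mulr0// => y _.
  by rewrite (fc x y) subrr mul0r.
pose q (z : H * H) : R := `|(f z.2 : R) - f z.1| / (gdist z.1 z.2)%:R.
have [[x y] _ qmax] := @Order.TotalTheory.arg_maxP _ R _ (x0, y0) xpredT q isT.
have q0 : 0 < q (x, y).
  apply: lt_le_trans (qmax (x0, y0) isT).
  have xy : x0 != y0 by apply: contraNneq fxy => ->.
  by rewrite divr_gt0 ?normr_gt0 ?subr_eq0 1?eq_sym// ltr0n gdist_gt0.
have xy : x != y.
  by apply: contraTneq q0 => <-; rewrite /q subrr normr0 mul0r ltxx.
have d0 : (gdist x y)%:R != 0 :> R by rewrite pnatr_eq0 -lt0n gdist_gt0.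
(* The quotient keeps its sign, so that after rescaling [g y - g x] equals the distance itself and
   not merely up to sign. *)
pose s : R := ((f y : R) - f x) / (gdist x y)%:R.
have qs : `|s| = q (x, y) by rewrite normrM normfV normr_nat.
have s0 : s != 0 by rewrite -normr_gt0 qs.
pose g : V := s^-1 *: f.
have gE z : (g z : R) = s^-1 * f z by rewrite ffunE.
have gd : (g y : R) - g x = (gdist x y)%:R.
  rewrite !gE -mulrBr -[X in _ * X](divfK d0) -/s.
  by rewrite mulKf.
have ga : laplacian g = a *: g by rewrite linearZ/= fa scalerA mulrC -scalerA.
have := Hk x y xy; rewrite /ollivier => kinf.
have : [set ((laplacian h y - laplacian h x : R) / (gdist x y)%:R)%:E
      | h in [set h : V | lipschitz1 h /\ h y - h x = (gdist x y)%:R]]%classic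
    ((laplacian g y - laplacian g x : R) / (gdist x y)%:R)%:E.
  exists g => //; split; last exact: gd.
  move=> u v; rewrite !gE -mulrBr normrM normfV qs distrC.
  have [->|uv] := eqVneq u v; first by rewrite subrr normr0 mulr0.
  rewrite ler_pdivrMl// -ler_pdivrMr ?ltr0n ?gdist_gt0//.
  exact: (qmax (u, v) isT).
move=> /ereal_inf_lbound/(le_trans kinf).
rewrite lee_fin ga.
have -> : ((a *: g) y - (a *: g) x : R) = a * ((g y : R) - g x).
  by rewrite !ffunE mulrBr.
by rewrite gd mulfK.
Qed.

End Laplacian.

(** * Dirichlet and Neumann Laplacians *)

Section Boundary.
Variables (R : realType) (G : wgraph R).
Implicit Types (S T B : {set G}).
Local Notation mip S := (ip (fun x : subV S => mass (val x))).

Lemma sum_subV S (F : G -> R) : \sum_(x : subV S) F (val x) = \sum_(x in S) F x.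
Proof.
by rewrite -big_sub.
Qed.

Lemma ext0_in S (u : rfun R (subV S)) (x : subV S) : ext0 u (val x) = u x.
Proof. by rewrite ffunE valK. Qed.

Lemma ext0_notin S (u : rfun R (subV S)) x : x \notin S -> ext0 u x = 0.
Proof. by move=> xS; rewrite ffunE insubN. Qed.

Lemma restr_ext0 S (u : rfun R (subV S)) : restr S (ext0 u) = u.
Proof. by apply/ffunP => x; rewrite ffunE ext0_in. Qed.

Lemma restr_ext0_disjoint S T (u : rfun R (subV S)) :
  [disjoint S & T] -> restr T (ext0 u) = 0.
Proof.
move=> ST; apply/ffunP => x; rewrite ffunE ext0_notin ?ffunE//.
by rewrite (disjointFl ST) ?(valP x).
Qed.

(** Terms outside [S] vanish. This adjointness of restriction and extension by zero carries the
    symmetry of the Laplacian over to its blocks. *)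
Lemma ip_restr S (f : rfun R G) (u : rfun R (subV S)) :
  mip S (restr S f) u = ip (@mass R G) f (ext0 u).
Proof.
transitivity (\sum_(x in S) mass x * ((f x : R) * ext0 u x)).
  by rewrite -sum_subV; apply: eq_bigr => x _; rewrite ext0_in ffunE.
rewrite big_mkcond; apply: eq_bigr => x _; case: ifPn => // xS.
by rewrite ext0_notin// !mulr0.
Qed.

(** On [T] the function [ext0 u] is 0, so only neighbouring values survive: up to sign, the
    adjacency operators are off-diagonal blocks of the Laplacian. *)
Lemma restr_laplacian_disjoint S T (u : rfun R (subV S)) : [disjoint S & T] ->
  restr T (laplacian (ext0 u)) = - wadj T u.
Proof.
move=> ST; apply/ffunP => x; rewrite [LHS]ffunE [laplacian _ _]ffunE [RHS]ffunE.
rewrite [wadj _ _ _]ffunE -mulrN; congr (_ * _).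
rewrite [in RHS](eq_bigr (fun y : subV S =>
  (ext0 u (val y) : R) * weight (val x) (val y))); last first.
  by move=> y _; rewrite ext0_in.
rewrite (sum_subV S (fun y => (ext0 u y : R) * weight (val x) y)) -sumrN.
rewrite [RHS]big_mkcond; apply: eq_bigr => y _.
have xS : val x \notin S by rewrite (disjointFl ST) ?(valP x).
rewrite (ext0_notin _ xS) sub0r mulNr; case: ifPn => // yS.
by rewrite (ext0_notin _ yS) mul0r oppr0.
Qed.

Lemma ip_wadj S T (u : rfun R (subV S)) (v : rfun R (subV T)) :
  [disjoint S & T] -> mip T (wadj T u) v = mip S u (wadj S v).
Proof.
move=> ST; have TS : [disjoint T & S] by rewrite disjoint_sym.
rewrite -[wadj T u]opprK -[wadj S v]opprK -!restr_laplacian_disjoint//.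
rewrite -scaleN1r -[in RHS]scaleN1r ipZl ipZr; congr (_ * _).
by rewrite ip_restr laplacian_sym [RHS]ipC ip_restr [RHS]ipC.
Qed.

Variable B : {set G}.
Local Notation Om := (~: B).
Local Notation "'L" := (@lap_op R (induced Om)).

Let BOm : [disjoint B & Om].
Proof. by rewrite disjoints_subset setCK. Qed.

Let OmB : [disjoint Om & B].
Proof. by rewrite disjoint_sym. Qed.

(** Interior neighbours give the induced Laplacian; each boundary neighbour y, where the extension
    is 0, contributes [u x] times its weight. *)
Lemma dirichlet_lapE (u : rfun R (subV Om)) :
  dirichlet_lap u = (@laplacian R (induced Om) u : rfun R (subV Om)) + mulDegB u.
Proof.
apply/ffunP => x; rewrite [LHS]ffunE [RHS]ffunE [mulDegB _ _]ffunE.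
have -> : (@laplacian R (induced Om) u : rfun R (subV Om)) x =
    (mass (val x))^-1 *
    \sum_(y : subV Om) ((u x : R) - u y) * weight (val x) (val y).
  by rewrite ffunE.
rewrite ffunE ext0_in /DegB -mulrA -mulrDr; congr (_ * _).
rewrite (bigID (mem Om))/= mulr_suml; congr (_ + _).
  by rewrite -sum_subV; apply: eq_bigr => y _; rewrite ext0_in.
apply: eq_big => y; first by rewrite in_setC negbK.
by move=> yO; rewrite (ext0_notin _ yO) subr0 mulrC.
Qed.

Lemma dirichlet_op_selfadj :
  selfadj (fun x : subV Om => mass (val x)) (dirichlet_op B).
Proof.
move=> u v; rewrite !lfunE /= /dirichlet_lap ip_restr laplacian_sym.
by rewrite [RHS]ipC ip_restr [RHS]ipC.
Qed.

(** * The Neumann Laplacian and the Schur complement *)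

Hypotheses (Gconn : connected G) (Bproper : Om != set0).

Lemma LB_selfadj : selfadj (fun x : subV B => mass (val x)) (linfun (@LB R G B)).
Proof.
move=> u v; rewrite !lfunE /= /LB ip_restr laplacian_sym.
by rewrite [RHS]ipC ip_restr [RHS]ipC.
Qed.

Lemma schur_opE (u : rfun R (subV Om)) :
  schur_op B u = mulDegB u - wadj Om ((linfun (@LB R G B))^-1%VF (wadj B u)).
Proof. by rewrite !lfun_simp. Qed.

Lemma schur_op_selfadj :
  selfadj (fun x : subV Om => mass (val x)) (schur_op B).
Proof.
move=> u v; rewrite !schur_opE -!scaleN1r !(ipDl, ipDr) ipZl ipZr.
congr (_ + _ * _).
  apply: eq_bigr => x _; congr (_ * _).
  by rewrite !ffunE [RHS]mulrCA mulrA.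
rewrite ip_wadj// [in RHS]ipC ip_wadj// [in RHS]ipC.
set z := wadj B u; set z' := wadj B v.
(* Writing [z'] as the image under [LB] of its preimage transfers self-adjointness from [LB] to its
   inverse. *)
rewrite -{1}(lker0_lfunVK (LB_inj Gconn Bproper) z').
by rewrite -LB_selfadj (lker0_lfunVK (LB_inj Gconn Bproper)).
Qed.

(** The harmonic extension has boundary values p = L_B^-1 A_Omega u, because on B the interior
    contributes - A_Omega u, which L_B p cancels. On the interior, p adds - A_B p to the Dirichlet
    Laplacian. *)
Lemma neumann_lapE (u : rfun R (subV Om)) :
  neumann_lap u = (@laplacian R (induced Om) u : rfun R (subV Om)) + schur_op B u.
Proof.
pose p := (linfun (@LB R G B))^-1%VF (wadj B u).
have LBp : LB p = wadj B u.
  by have := lker0_lfunVK (LB_inj Gconn Bproper) (wadj B u); rewrite lfunE.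
rewrite /neumann_lap; have <- : ext0 u + ext0 p = harm_ext u.
  apply/(harm_extP Gconn Bproper); rewrite !linearD/= restr_ext0.
  rewrite restr_ext0_disjoint// addr0 restr_laplacian_disjoint// -/(LB p) LBp.
  by rewrite addNr.
rewrite !linearD/= -/(dirichlet_lap u) dirichlet_lapE restr_laplacian_disjoint//.
by rewrite schur_opE addrA.
Qed.

(** Evaluating [linfun] requires linearity, which for [neumann_lap] is a lemma under the section
    hypotheses; hence the locally packed linear map. *)
Lemma neumann_opE (u : rfun R (subV Om)) : neumann_op B u = neumann_lap u.
Proof.
pose N : {linear rfun R (subV Om) -> rfun R (subV Om)} :=
  HB.pack (@neumann_lap R G B)
    (GRing.isLinear.Build R _ _ _ _ (neumann_lap_linear Gconn Bproper)).
by rewrite [LHS](lfunE N).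
Qed.

Lemma card_subV S : #|{: subV S}| = #|S|.
Proof. by rewrite card_sig; apply: eq_card. Qed.

Lemma eigval_ge_gap (c : R) (i : nat) :
  connected (induced Om) -> 0 < c ->
  (forall a (f : rfun R (induced Om)),
    f != 0 -> laplacian f = a *: f -> a != 0 -> c <= a) ->
  (2 <= i <= #|Om|)%N ->
  c + DegB_sorted B i.-1 <= eigval (dirichlet_op B) i /\
  c + eigval (schur_op B) i.-1 <= eigval (neumann_op B) i.
Proof.
move=> Oc c0 gap /andP[i2 iN].
have m_gt0 (x : subV Om) : 0 < mass (val x) := mass_gt0 (val x).
have cardO : #|{: subV Om}| = #|Om| := card_subV Om.
(* Codimension 1 comes from the second eigenvalue of the induced Laplacian, codimension [i.-2] from
   the value of index [i.-1] of the perturbation. *)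
have iN' : (1 + i.-2 < i <= #|{: subV Om}|)%N by rewrite cardO iN andbT; lia.
have cgap : c <= eigval 'L 2.
  by apply: spectral_gap => //; rewrite cardO (leq_trans i2).
have Lge : form_ge (fun x : subV Om => mass (val x)) 'L (eigval 'L 2) 1.
  exact: (form_ge_eigval m_gt0 2 (@lap_op_selfadj R (induced Om))).
split.
  apply: (@le_trans _ _ (eigval 'L 2 + DegB_sorted B i.-1)).
    by rewrite lerD2r.
  have DegE (u : rfun R (subV Om)) x : linfun (@mulDegB R G B) u x = DegB x * u x.
    by rewrite lfunE ffunE.
  have := form_ge_mul m_gt0 i.-2 DegE.
  move/(weyl m_gt0 dirichlet_op_selfadj _ Lge); apply=> // u.
  rewrite lfunE /= dirichlet_lapE; congr (_ + _); last by rewrite lfunE.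
  exact/esym/(@lap_opE R (induced Om)).
apply: (@le_trans _ _ (eigval 'L 2 + eigval (schur_op B) i.-1)).
  by rewrite lerD2r.
have opE (u : rfun R (subV Om)) : neumann_op B u = 'L u + schur_op B u.
  rewrite neumann_opE neumann_lapE; congr (_ + _).
  exact/esym/(@lap_opE R (induced Om)).
have opS : selfadj (fun x : subV Om => mass (val x)) (neumann_op B).
  move=> u v; rewrite !opE ipDl ipDr schur_op_selfadj; congr (_ + _).
  exact: (@lap_op_selfadj R (induced Om)).
have schurS := form_ge_eigval m_gt0 i.-1 schur_op_selfadj.
exact: (weyl m_gt0 opS opE Lge schurS iN').
Qed.

End Boundary.

Theorem theorem6p2 (R : realType) (G : wgraph R) (B : {set G}) :
  B != set0 -> connected G ->
  (forall K n : R,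
     connected (induced (~: B)) -> CD (induced (~: B)) K n ->
     0 < K -> 1 < n ->
     forall i : nat, (2 <= i <= #|~: B|)%N ->
       eigval (dirichlet_op B) i >= n * K / (n - 1) + DegB_sorted B i.-1 /\
       eigval (neumann_op B) i >= n * K / (n - 1) + eigval (schur_op B) i.-1)
  /\
  (forall k : R,
     connected (induced (~: B)) -> ollivier_ge (induced (~: B)) k ->
     0 < k ->
     forall i : nat, (2 <= i <= #|~: B|)%N ->
       eigval (dirichlet_op B) i >= k + DegB_sorted B i.-1 /\
       eigval (neumann_op B) i >= k + eigval (schur_op B) i.-1).
Proof.
move=> _ Gconn.
(* The index range itself supplies the nonempty interior on which harmonic extension relies. *)
have proper i : (2 <= i <= #|~: B|)%N -> ~: B != set0.
  by case/andP=> i2 iB; rewrite -card_gt0 (leq_trans _ iB)// ltnW.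
split=> [K n Oc HCD K0 n1 i iB | k Oc Hk k0 i iB].
  apply: eigval_ge_gap (proper _ iB) _ _ _ _ _ _ => //.
    by rewrite divr_gt0 ?mulr_gt0 ?subr_gt0// (lt_trans ltr01).
  by move=> a f f0 fa a0; apply: CD_eigenvalue_ge HCD K0 n1 f0 fa a0.
apply: eigval_ge_gap (proper _ iB) _ _ _ _ _ _ => //.
by move=> a f f0 fa a0; apply: ollivier_eigenvalue_ge Hk fa a0 f0.
Qed.
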